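(* Let $\theta^0_1,\theta^0_2,\tilde\theta^1,\theta^\infty_1,\theta^\infty_2,\theta^\infty_3\in\mathbb{C}$ satisfy $\theta^0_1+\theta^0_2+\tilde\theta^1+\theta^\infty_1+\theta^\infty_2+\theta^\infty_3=0$. For small $\varepsilon\neq0$ put $$\theta^1=-\varepsilon^{-1},\quad \theta^t=\tilde\theta^1+\varepsilon^{-1},\quad t=1+\varepsilon\tilde t,\quad q_1=1+\varepsilon\tilde t\,\tilde q_2,\quad p_1=\varepsilon^{-1}\tilde t^{-1}\tilde p_2,\quad q_2=1+\varepsilon\tilde t\,\tilde q_1,\quad p_2=\varepsilon^{-1}\tilde t^{-1}\tilde p_1,$$ and define $\tilde H=\tilde H_\varepsilon(\tilde t;\tilde q_1,\tilde p_1,\tilde q_2,\tilde p_2)$ by $$H_{\mathrm{FS}}^{A_5}\left({\theta^0_2+\theta^\infty_2,\ \theta^\infty_3,\ \theta^t\atop\theta^1,\ \theta^0_1,\ \theta^0_2};t;{q_1,p_1\atop q_2,p_2}\right)=\varepsilon^{-1}\left(\tilde H+\tilde t^{-1}(\tilde p_1\tilde q_1+\tilde p_2\tilde q_2)\right).$$ Then, up to an additive term independent of $\tilde q_1,\tilde p_1,\tilde q_2,\tilde p_2$, for every $\tilde t\neq0$ and all $\tilde q_i,\tilde p_i$, $$\lim_{\varepsilon\to0}\tilde H=H_{\mathrm{NY}}^{A_5}\left({\theta^\infty_1-\theta^\infty_3-1,\ \theta^\infty_3,\ -\theta^\infty_2\atop\theta^0_2+\theta^\infty_2,\ \theta^0_1-\theta^0_2};\tilde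 t;{\tilde q_1,\tilde p_1\atop\tilde q_2,\tilde p_2}\right).$$
   Context: Hamiltonians of the sixth and fifth Painlevé equations: $$t(t-1)H_{\mathrm{VI}}\left({\alpha,\beta\atop\gamma,\delta};t;q,p\right)=q(q-1)(q-t)p^2+\{\delta q(q-1)-(2\alpha+\beta+\gamma+\delta)q(q-t)+\gamma(q-1)(q-t)\}p+\alpha(\alpha+\beta)(q-t),$$ $$tH_{\mathrm V}\left({\alpha,\beta\atop\gamma};t;q,p\right)=p(p+t)q(q-1)+\beta pq+\gamma p-(\alpha+\gamma)tq.$$ Fuji–Suzuki Hamiltonian of type $A_5^{(1)}$: $$t(t-1)H_{\mathrm{FS}}^{A_5}\left({\alpha,\beta,\gamma\atop\delta,\epsilon,\omega};t;{q_1,p_1\atop q_2,p_2}\right)=t(t-1)H_{\mathrm{VI}}\left({\alpha,\ \beta+\delta\atop\beta+\gamma,\ \epsilon-\omega+1};t;q_1,p_1\right)+t(t-1)H_{\mathrm{VI}}\left({\beta,\ \alpha+\delta\atop\alpha+\gamma,\ \epsilon-\alpha+1};t;q_2,p_2\right)$$ $$+(q_1-t)(q_2-1)\{(p_1q_1-\alpha)p_2+p_1(p_2q_2-\beta)\}.$$ Noumi–Yamada Hamiltonian of type $A_5^{(1)}$: $$tH_{\mathrm{NY}}^{A_5}\left({\alpha,\beta,\gamma\atop\delta,\epsilon};t;{q_1,p_1\atop q_2,p_2}\right)=tH_{\mathrm V}\left({\alpha+\beta,\ \alpha+\gamma+\epsilon\atop-\alpha};t;q_1,p_1\right)+tH_{\mathrm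 V}\left({\alpha+\gamma+\delta,\ \alpha+\gamma+\epsilon\atop-\alpha-\gamma};t;q_2,p_2\right)+2p_1p_2q_1(q_2-1).$$ Terms of a Hamiltonian not involving the canonical variables are irrelevant to the Hamiltonian system and are added or dropped freely. *)

(* Defs.v *)
From mathcomp Require Import all_boot all_order all_algebra.
From mathcomp Require Import complex.
From mathcomp Require Import all_classical all_reals all_analysis.

Set Implicit Arguments.
Unset Strict Implicit.
Unset Printing Implicit Defensive.

Import GRing.Theory.
Local Open Scope ring_scope.

(* R[i] packed as a numFieldType, so that the topology given by the modulus,
   which numFieldNormedType attaches to an arbitrary numFieldType, is found. *)
Definition Cplx (R : realType) : numFieldType := R[i]%C.

(* The Hamiltonians are specified through t (t - 1) H or t H; here they are
   solved for H.  They are meaningful when the denominator is nonzero, i.e. for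
   t <> 0, 1 (H_VI, H_FS) and t <> 0 (H_V, H_NY). *)
Section Hamiltonians.
Variable F : fieldType.
Implicit Types al be ga de ep om t q p : F.

Definition HVI al be ga de t q p : F :=
  (q * (q - 1) * (q - t) * p ^+ 2
   + (de * q * (q - 1) - (2 * al + be + ga + de) * q * (q - t)
      + ga * (q - 1) * (q - t)) * p
   + al * (al + be) * (q - t)) / (t * (t - 1)).

Definition HV al be ga t q p : F :=
  (p * (p + t) * q * (q - 1) + be * p * q + ga * p - (al + ga) * t * q) / t.

Definition HFS_A5 al be ga de ep om t q1 p1 q2 p2 : F :=
  (t * (t - 1) * HVI al (be + de) (be + ga) (ep - om + 1) t q1 p1
   + t * (t - 1) * HVI be (al + de) (al + ga) (ep - al + 1) t q2 p2
   + (q1 - t) * (q2 - 1)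
     * ((p1 * q1 - al) * p2 + p1 * (p2 * q2 - be))) / (t * (t - 1)).

Definition HNY_A5 al be ga de ep t q1 p1 q2 p2 : F :=
  (t * HV (al + be) (al + ga + ep) (- al) t q1 p1
   + t * HV (al + ga + de) (al + ga + ep) (- al - ga) t q2 p2
   + 2 * p1 * p2 * q1 * (q2 - 1)) / t.

End Hamiltonians.

(* Main.v *)
Require Import Defs.
From mathcomp Require Import all_boot all_order all_algebra.
From mathcomp Require Import all_classical all_reals all_analysis.
From mathcomp Require Import ring.
Import GRing.Theory numFieldNormedType.Exports.
Local Open Scope classical_set_scope.
Local Open Scope ring_scope.

(** The substitution is the classical confluence of the sixth Painleve
    Hamiltonian to the fifth one: when the singular points 1 and t = 1 + eps tt
    merge, with q measured from 1 in units of t - 1 and p in the inverse unit,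
    the only parameters that blow up are the second and the third one, as
    - eps^-1 and + eps^-1.  Their sum stays finite, and apart from it they only
    enter through ga (q - 1) (q - t) p and al be (q - t), where the coefficients
    (q - 1) (q - t) p and q - t are of size eps.  Hence the numerator
    t (t - 1) HVI is an affine function of eps whose value at eps = 0 is, up to
    a constant, the numerator of HV ([HVI_confluence]).

    HFS_A5 consists of two such blocks and of a coupling term, whose numerator
    is affine in eps as well.  The term tt^-1 (tp1 tq1 + tp2 tq2) comes from the
    time dependence of the change of variables; subtracting it shifts the
    second parameter of both copies of HV by one.  The relation between the
    exponents then identifies the value at eps = 0 with HNY_A5 plus the constant
    th02 + thoo2 + thoo3 ([HFS_A5_confluence]).  Thus tH is, for small
    eps <> 0, an affine function of eps divided by tt (1 + eps tt), minus a term
    independent of eps, and its limit is obtained by putting eps = 0. *)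

(** Coefficient of eps in the rescaled numerator of HVI, divided by tt; in the
    same way for the coupling term and for HFS_A5.  The substitution exchanges
    the two pairs of canonical variables, so in the last two the block with
    leading parameter al is the one in q2, p2. *)
Definition HVI_slope {F : fieldType} (al be ga de q p : F) : F :=
  q ^+ 2 * (q - 1) * p ^+ 2
  + (de * q ^+ 2 - (2 * al + be + ga + de) * q * (q - 1) + ga * q * (q - 1)) * p
  + al * (al + be) * (q - 1).

Definition coupling_slope {F : fieldType} (al be q1 p1 q2 p2 : F) : F :=
  q1 * (q2 - 1) * (p1 * p2 * (q1 + q2) - al * p1 - be * p2).

Definition HFS_slope {F : fieldType} (al be ga ep om q1 p1 q2 p2 : F) : F :=
  HVI_slope al be (be + ga) (ep - om + 1) q2 p2
  + HVI_slope be al (al + ga) (ep - al + 1) q1 p1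
  + coupling_slope al be q1 p1 q2 p2.

(** Confluence of HVI to HV.  The poles of the parameters contribute in the limit
    the terms tt p q (q - 1) and - al tt (q - 1): the first one completes
    p ^+ 2 q (q - 1) to p (p + tt) q (q - 1). *)
Lemma HVI_confluence {F : fieldType} (eps tt al be ga de q p : F) :
  eps != 0 -> tt != 0 -> 1 + eps * tt != 0 ->
  let t := 1 + eps * tt in
  let si := 2 * al + be + ga + de in
  t * (t - 1) * HVI al (be - eps^-1) (ga + eps^-1) de t
                    (1 + eps * tt * q) (eps^-1 * tt^-1 * p)
  = tt * HV (al - si) (de - si) si tt q p + al * tt
    + eps * (tt * HVI_slope al be ga de q p).
Proof.
move=> e0 t0 u0 /=; rewrite /HVI /HV /HVI_slope.
have -> : 1 + eps * tt - 1 = eps * tt by ring.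
by field; rewrite u0 t0 e0.
Qed.

Lemma coupling_confluence {F : fieldType} (eps tt al be q1 p1 q2 p2 : F) :
  eps != 0 -> tt != 0 ->
  let x q := 1 + eps * tt * q in
  let y p := eps^-1 * tt^-1 * p in
  (x q2 - (1 + eps * tt)) * (x q1 - 1)
    * ((y p2 * x q2 - al) * y p1 + y p2 * (y p1 * x q1 - be))
  = 2 * p1 * p2 * q1 * (q2 - 1)
    + eps * (tt * coupling_slope al be q1 p1 q2 p2).
Proof.
by move=> e0 t0 /=; rewrite /coupling_slope; field; rewrite t0 e0.
Qed.

(** The sixth exponent thoo1 enters HNY_A5 but not HFS_A5, hence is eliminated
    by means of the relation.  The constant th02 + thoo2 + thoo3 collects the
    terms al tt left over by the two blocks, and p1 q1 + p2 q2 the shift by one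
    of the second parameter of each HV. *)
Lemma HFS_A5_confluence {F : fieldType}
    (eps tt th01 th02 tth1 thoo1 thoo2 thoo3 q1 p1 q2 p2 : F) :
  th01 + th02 + tth1 + thoo1 + thoo2 + thoo3 = 0 ->
  eps != 0 -> tt != 0 -> 1 + eps * tt != 0 ->
  let t := 1 + eps * tt in
  eps * HFS_A5 (th02 + thoo2) thoo3 (tth1 + eps^-1) (- eps^-1) th01 th02 t
          (1 + eps * tt * q2) (eps^-1 * tt^-1 * p2)
          (1 + eps * tt * q1) (eps^-1 * tt^-1 * p1)
  = (tt * (HNY_A5 (thoo1 - thoo3 - 1) thoo3 (- thoo2) (th02 + thoo2)
             (th01 - th02) tt q1 p1 q2 p2 + (th02 + thoo2 + thoo3))
     + (p1 * q1 + p2 * q2)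
     + eps * (tt * HFS_slope (th02 + thoo2) thoo3 tth1 th01 th02 q1 p1 q2 p2))
    / (tt * (1 + eps * tt)).
Proof.
move=> rel e0 t0 u0 /=.
have -> : thoo1 = - (th01 + th02 + tth1 + thoo2 + thoo3).
  by apply/eqP; rewrite -subr_eq0 -rel; apply/eqP; ring.
rewrite /HFS_A5 !(addrA _ tth1) !HVI_confluence// coupling_confluence//.
rewrite /HFS_slope /HNY_A5 /HV.
have -> : 1 + eps * tt - 1 = eps * tt by ring.
by field; rewrite u0 t0 e0.
Qed.

Lemma cvg_affine (K : numFieldType) (F : set_system K) {FF : Filter F}
    (a b : K) :
  F --> (0 : K) -> a + eps * b @[eps --> F] --> a.
Proof.
move=> F0; rewrite -[X in _ --> X]addr0 -[in X in _ --> X](mul0r b).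
by apply: cvgD; [exact: cvg_cst | apply: cvgM => //; exact: cvg_cst].
Qed.

Lemma cvg_affine_div (K : numFieldType) (a b c tt : K) : tt != 0 ->
  (a + eps * b) / (tt * (1 + eps * tt)) - c @[eps --> (0 : K)^'] --> a / tt - c.
Proof.
move=> t0; apply: cvgB; last exact: cvg_cst.
apply: cvgM; first by apply: cvg_affine; exact: nbhs_dnbhs.
apply: cvgV => //; rewrite -[X in _ --> X]mulr1.
by apply: cvgM; [exact: cvg_cst | apply: cvg_affine; exact: nbhs_dnbhs].
Qed.

Lemma near0_affine_neq0 (K : numFieldType) (tt : K) :
  \forall eps \near (0 : K)^', 1 + eps * tt != 0.
Proof.
apply: (@cvgr_neq0 _ _ _ _ _ _ (1 : K)); last exact: oner_neq0.
by apply: cvg_affine; exact: nbhs_dnbhs.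
Qed.

Theorem mainTheorem17 (R : realType)
    (th01 th02 tth1 thoo1 thoo2 thoo3 : Cplx R)
    (Hrel : th01 + th02 + tth1 + thoo1 + thoo2 + thoo3 = 0)
    (tH : Cplx R -> Cplx R -> Cplx R -> Cplx R -> Cplx R -> Cplx R -> Cplx R)
    (HtH : forall tt : Cplx R, tt != 0 ->
      \forall eps \near (0 : Cplx R)^', forall tq1 tp1 tq2 tp2 : Cplx R,
        let th1 := - eps^-1 in
        let tht := tth1 + eps^-1 in
        let t := 1 + eps * tt in
        let q1 := 1 + eps * tt * tq2 in
        let p1 := eps^-1 * tt^-1 * tp2 in
        let q2 := 1 + eps * tt * tq1 in
        let p2 := eps^-1 * tt^-1 * tp1 in
        HFS_A5 (th02 + thoo2) thoo3 tht th1 th01 th02 t q1 p1 q2 p2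
        = eps^-1 * (tH eps tt tq1 tp1 tq2 tp2
                    + tt^-1 * (tp1 * tq1 + tp2 * tq2))) :
  exists c : Cplx R -> Cplx R,
    forall tt : Cplx R, tt != 0 -> forall tq1 tp1 tq2 tp2 : Cplx R,
      tH eps tt tq1 tp1 tq2 tp2 @[eps --> (0 : Cplx R)^'] -->
        HNY_A5 (thoo1 - thoo3 - 1) thoo3 (- thoo2) (th02 + thoo2) (th01 - th02)
               tt tq1 tp1 tq2 tp2 + c tt.
Proof.
exists (fun=> th02 + thoo2 + thoo3) => tt t0 tq1 tp1 tq2 tp2.
set L := (X in _ --> X).
set C := tp1 * tq1 + tp2 * tq2.
pose B := tt * HFS_slope (th02 + thoo2) thoo3 tth1 th01 th02 tq1 tp1 tq2 tp2.
have -> : L = (tt * L + C) / tt - tt^-1 * C.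
  by rewrite mulrDl mulrAC divff// mul1r (mulrC C) addrK.
apply: cvg_trans; last exact: (cvg_affine_div _ _ B (tt^-1 * C) _ t0).
apply: near_eq_cvg; near=> eps.
have e0 : eps != 0 by near: eps; exact: nbhs_dnbhs_neq.
have u0 : 1 + eps * tt != 0 by near: eps; exact: near0_affine_neq0.
rewrite /B /C /L -(HFS_A5_confluence _ _ _ _ _ _ _ _ _ _ _ _ Hrel)//.
rewrite (near (HtH tt t0) eps _ tq1 tp1 tq2 tp2)//.
by rewrite mulrA divff// mul1r addrK.
Unshelve. all: end_near.
Qed.
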